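(* Consider the following two-bidder auction with limit price $L>0$. A single good has common value $v$ with CDF $F_v$, density $f_v$, support $\mathbb{R}_+$ and finite mean, $\mathbb{E}[v]>L$, and $\underline v$ in the support of $F_v$ satisfies $L=\mathbb{E}[\tilde v\mid\tilde v<\underline v]$ ($\tilde v\sim F_v$). Alice bids knowing only $F_v$; then $v$ is realized and Bob, observing $v$ but not Alice's bid, bids. The highest bid wins and pays its bid (payoff $v$ minus bid) unless it is strictly below $L$, in which case the good is unsold. If bids tie, Bob wins; Bob can win with a bid equal to $L$; a winning bid of Alice equal exactly to $L$ results in no sale. Let $$\beta_L(v)=\begin{cases}\mathbb{E}[\tilde v\mid \tilde v<v] & v\ge \underline v,\\ L & L<v<\underline v,\\ 0 & v\le L,\end{cases}$$ and consider the equilibrium in which Bob bids $\beta_L(v)$ and Alice draws $v'\sim F_v$ independently and bids $\beta_L(v')$. Then Bob's expected profit is $$\begin{aligned}\Pi_B&=\mathbb{E}\left[\max\left(v_1\mathbf{1}\{v_1\ge\underline v\}-v_2\mathbf{1}\{v_2\ge\underline v\},0\right)\right]+\mathbb{E}\left[(v_1-L)\mathbf{1}\{L<v_1<\underline v\}\mathbf{1}\{v_2<\underline v\}\right]-\mathbb{E}\left[v_1\mathbf{1}\{v_1<\underline v\}\mathbf{1}\{v_2\ge\underline v\}\right]\\&=\mathbb{E}\left[\max\left(v_1\mathbf{1}\{v_1\ge\underline v\}-v_2\mathbf{1}\{v_2\ge\underline v\},0\right)\right]+F_v(\underline v)\,\mathbb{E}\left[(v-L)\mathbf{1}\{L<v<\underline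 v\}\right]-(1-F_v(\underline v))\,\mathbb{E}[v\mathbf{1}\{v<\underline v\}],\end{aligned}$$ where $v_1,v_2$ are i.i.d. draws from $F_v$ and $v\sim F_v$.
   Context: Bidders are risk neutral. $\mathbf{1}\{\cdot\}$ denotes an indicator. *)

(* Defs.v *)
From HB Require Import structures.
From mathcomp Require Import all_boot all_order all_algebra.
From mathcomp Require Import all_classical all_reals all_analysis.
Set Implicit Arguments. Unset Strict Implicit. Unset Printing Implicit Defensive.
Import Order.TTheory GRing.Theory Num.Theory.
Import numFieldNormedType.Exports.
Local Open Scope classical_set_scope.
Local Open Scope ring_scope.

Section auction.
Variable R : realType.
Variable P : probability R R.

Definition condmean (v : R) : R :=
  fine (\int[P]_(x in [set` `]-oo, v[]) x%:E)%E / fine (P [set` `]-oo, v[]).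

Definition betaL (L vl v : R) : R :=
  if vl <= v then condmean v else if L < v then L else 0.

Definition bob_payoff (L v bA bB : R) : R :=
  if (bA <= bB) && (L <= bB) then v - bB else 0.

Definition bob_eq_payoff (L vl : R) (z : R * R) : R :=
  bob_payoff L z.1 (betaL L vl z.2) (betaL L vl z.1).

End auction.

(* Main.v *)
(* Fix Bob's value x and integrate over Alice's independent value y.  If
   x >= vl, strict monotonicity of v |-> E[v~ | v~ < v] on [vl, oo) shows that Bob
   wins exactly when y <= x, so he gets (x - E[v~ | v~ < x]) F(x) =
   E[(x - v~) 1{v~ < x}]; this is E[max(x - v~ 1{v~ >= vl}, 0)] minus
   E[v~ 1{v~ < vl}].  If L < x < vl he bids L and wins exactly when y <= vl.
   Fubini, together with the exchange of the two i.i.d. values in the subtracted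
   term, gives both formulas. *)
Require Import Defs.
From HB Require Import structures.
From mathcomp Require Import all_boot all_order all_algebra.
From mathcomp Require Import all_classical all_reals all_analysis.
From mathcomp Require Import measurable_realfun lra.
Import Order.TTheory GRing.Theory Num.Theory.
Import numFieldNormedType.Exports.
Local Open Scope classical_set_scope.
Local Open Scope ring_scope.

(** * Strict monotonicity of the truncated mean *)

Section truncated_mean.
Context {R : realType}.
Variable P : probability R R.
Hypothesis P_supp : forall a b : R, 0 <= a -> a < b -> (0 < P [set` `]a, b[])%E.
Hypothesis P_mean : P.-integrable setT (fun x => x%:E).

Definition mass_below (v : R) : R := fine (P [set` `]-oo, v[]).
Definition moment_below (v : R) : R := fine (\int[P]_(x in [set` `]-oo, v[]) x%:E)%E.

Lemma condmeanE v : condmean P v = moment_below v / mass_below v.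
Proof. by []. Qed.

Lemma integrable_id_on (A : set R) : measurable A -> P.-integrable A (EFin \o id).
Proof. by move=> mA; exact: integrableS P_mean. Qed.

Lemma integrable_cst_on (A : set R) c : measurable A -> P.-integrable A (EFin \o cst c).
Proof. exact: finite_measure_integrable_cst. Qed.

Lemma moment_below_le v : moment_below v <= v * mass_below v.
Proof.
rewrite /mass_below -Rintegral_cst//; apply: le_Rintegral => //.
- exact: integrable_id_on.
- exact: integrable_cst_on.
- by move=> x /=; rewrite in_itv/= => /ltW.
Qed.

Lemma below_split (s t : R) : s <= t ->
  [set` `]-oo, t[] = [set` `]-oo, s[] `|` [set` `[s, t[].
Proof.
move=> st; apply/seteqP; split => x /=; rewrite !in_itv/=.
  by move=> xt; have [xs|sx] := ltP x s; [left|right; rewrite xt].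
by case=> [/lt_le_trans->//|/andP[]].
Qed.

Lemma below_disj (s t : R) : [disjoint [set` `]-oo, s[] & [set` `[s, t[]].
Proof.
apply/disj_setPS => x /= []; rewrite !in_itv/= => xs /andP[sx _].
by move: (lt_le_trans xs sx); rewrite ltxx.
Qed.

Lemma mass_belowB (s t : R) : s <= t ->
  mass_below t - mass_below s = fine (P [set` `[s, t[]).
Proof.
move=> st; rewrite /mass_below (below_split _ _ st) measureU//.
  by rewrite fineD ?fin_num_measure// addrAC subrr add0r.
exact/disj_set2P/below_disj.
Qed.

(** The increment of [moment_below] is the integral of [x] over [[s, t[], where the integrand lies
    between [s] and [t]. *)
Lemma moment_belowB (s t : R) : s <= t ->
  s * (mass_below t - mass_below s) <= moment_below t - moment_below s
    <= t * (mass_below t - mass_below s).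
Proof.
move=> st; rewrite mass_belowB//.
have -> : moment_below t - moment_below s = (\int[P]_(x in [set` `[s, t[]) x)%R.
  rewrite /moment_below -!/(Rintegral _ _ _) (below_split _ _ st) Rintegral_setU//.
  - by rewrite addrAC subrr add0r.
  - by apply: integrable_id_on; exact: measurableU.
  - exact: below_disj.
rewrite -!Rintegral_cst//; apply/andP; split; apply: le_Rintegral => //;
  do ?[exact: integrable_id_on|exact: integrable_cst_on].
- by move=> x /=; rewrite in_itv/= => /andP[].
- by move=> x /=; rewrite in_itv/= => /andP[_ /ltW].
Qed.

Lemma mass_below_lt (s t : R) : 0 <= s -> s < t -> mass_below s < mass_below t.
Proof.
move=> s0 st; rewrite -subr_gt0 mass_belowB ?(ltW st)// fine_gt0//.
apply/andP; split; last by rewrite ltey_eq fin_num_measure.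
apply: (lt_le_trans (P_supp _ _ s0 st)); apply: le_measure; rewrite ?inE//.
by apply: subset_itv; rewrite bnd_simp.
Qed.

Lemma mass_below_ge0 v : 0 <= mass_below v.
Proof. exact: fine_ge0. Qed.

Lemma mass_below_gt0 v : 0 < v -> 0 < mass_below v.
Proof. by move=> v0; apply: le_lt_trans (mass_below_lt 0 _ _ v0) => //; exact: mass_below_ge0. Qed.

Lemma moment_below_lt v : 0 < v -> moment_below v < v * mass_below v.
Proof.
(* Cutting at [v / 2] gives strictness: positive mass lies below it, where values fall short of [v]
   by at least [v / 2]. *)
move=> v0; have h0 : 0 < v / 2 by lra.
have hv : v / 2 <= v by lra.
have := moment_belowB _ _ hv; have := moment_below_le (v / 2).
have := mass_below_gt0 _ h0 => p0 mh /andP[_ mv].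
have : 0 < v / 2 * mass_below (v / 2) by exact: mulr_gt0.
lra.
Qed.

Lemma condmean_le v : 0 < v -> condmean P v <= v.
Proof.
by move=> v0; rewrite condmeanE ler_pdivrMr ?mass_below_gt0// moment_below_le.
Qed.

(** Raising the cutoff adds positive mass at values at least [s], whereas the mean below [s] is
    strictly less than [s]. *)
Lemma condmean_lt (s t : R) : 0 < s -> s < t -> condmean P s < condmean P t.
Proof.
move=> s0 st; have t0 := lt_trans s0 st.
have ps := mass_below_gt0 _ s0; have pt := mass_below_gt0 _ t0.
rewrite !condmeanE ltr_pdivrMr// mulrAC ltr_pdivlMr//.
have /andP[h _] := moment_belowB _ _ (ltW st).
have dp := mass_below_lt _ _ (ltW s0) st.
have ms := moment_below_lt _ s0.
set a := moment_below s in h ms *; set b := moment_below t in h *.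
set p := mass_below s in h ms dp ps *; set q := mass_below t in h dp *.
(* Cross-multiplied, the goal is [a * q < b * p]; it follows from [(q - p) * a < (q - p) * (s * p)
   <= p * (b - a)] by adding [p * a]. *)
have : (q - p) * a < (q - p) * (s * p) by rewrite ltr_pM2l// subr_gt0.
have : p * (s * (q - p)) <= p * (b - a) by rewrite ler_pM2l.
nra.
Qed.

Lemma condmean_le_mono (s t : R) : 0 < s -> s <= t -> condmean P s <= condmean P t.
Proof.
by move=> s0; rewrite le_eqVlt => /predU1P[->//|st]; exact/ltW/condmean_lt.
Qed.

Lemma condmean_leE (s t : R) : 0 < s -> 0 < t -> (condmean P s <= condmean P t) = (s <= t).
Proof.
move=> s0 t0; have [st|ts] := leP s t; first by rewrite condmean_le_mono.
by apply/negbTE; rewrite -ltNge condmean_lt.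
Qed.

End truncated_mean.

(** * Integrability and independence for two i.i.d. values *)

Section product_square.
Context {R : realType}.
Variable P : probability R R.
Hypothesis P_mean : P.-integrable setT (fun x => x%:E).

Lemma integrable_fst : (P \x P)%E.-integrable setT (fun z : R * R => (z.1)%:E).
Proof.
have mf : measurable_fun setT (EFin \o @fst R R).
  by apply/measurable_EFinP; exact: measurable_fst.
apply/(integrable12ltyP P P mf) => /=.
under eq_integral => x _.
  rewrite (integral_cst _ measurableT `|x%:E|%E) -[X in (_ * X)%E]/(P setT) probability_setT mule1.
  over.
by have /integrableP[] := P_mean.
Qed.

Lemma integrable_snd : (P \x P)%E.-integrable setT (fun z : R * R => (z.2)%:E).
Proof.
have mf : measurable_fun setT (EFin \o @snd R R).
  by apply/measurable_EFinP; exact: measurable_snd.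
apply/(integrable21ltyP P P mf) => /=.
under eq_integral => x _.
  rewrite (integral_cst _ measurableT `|x%:E|%E) -[X in (_ * X)%E]/(P setT) probability_setT mule1.
  over.
by have /integrableP[] := P_mean.
Qed.

(** Domination by the two coordinates, each of finite mean, plus a constant. Every integrand on the
    square is handled this way. *)
Lemma integrable_linear_growth (h : R * R -> R) (C : R) :
  measurable_fun setT h -> (forall z, `|h z| <= `|z.1| + `|z.2| + C) ->
  (P \x P)%E.-integrable setT (EFin \o h).
Proof.
move=> mh hC.
have ic : (P \x P)%E.-integrable setT (EFin \o cst `|C| : R * R -> \bar R).
  pose Q : probability (R * R)%type R := (P \x P)%E.
  exact: (@finite_measure_integrable_cst _ _ _ Q setT `|C| measurableT).
have ig : (P \x P)%E.-integrable setT
    (fun z : R * R => `|(z.1)%:E| + `|(z.2)%:E| + `|C|%:E)%E.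
  apply: integrableD => //; apply: integrableD => //; apply: integrable_abse.
    exact: integrable_fst.
  exact: integrable_snd.
apply: le_integrable ig => //; first exact/measurable_EFinP.
move=> z _ /=; rewrite lee_fin [leRHS]ger0_norm ?addr_ge0//.
by apply: (le_trans (hC z)); rewrite lerD2l ler_norm.
Qed.

Lemma integral_if_cst (b : R -> bool) (a : R) : measurable [set y | b y] ->
  (\int[P]_y (if b y then a else 0)%:E = a%:E * P [set y | b y])%E.
Proof.
move=> mb; rewrite -integral_cst// [RHS]integral_mkcond.
apply: eq_integral => y _; rewrite patchE /=.
by case: ifPn => by_; [rewrite mem_set|rewrite memNset//; exact/negP].
Qed.

(** Independence: integrating the second coordinate first leaves the probability of [b] as a
    constant factor. *)
Lemma integral_prod_if1 (g : R -> R) (b : R -> bool) : measurable_fun setT b ->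
  P.-integrable setT (EFin \o g) ->
  (P \x P)%E.-integrable setT (fun z : R * R => (if b z.2 then g z.1 else 0)%:E) ->
  (\int[P \x P]_z (if b z.2 then g z.1 else 0)%:E =
   P [set y | b y] * \int[P]_x (g x)%:E)%E.
Proof.
move=> mb ig ih; rewrite -integral12_prod_meas1//= /fubini_F /=.
have mB : measurable [set y | b y].
  by have := mb measurableT [set true]; rewrite setTI; apply.
have -> : (fun x : R => \int[P]_y (if b y then g x else 0)%:E)%E =
          (fun x => (fine (P [set y | b y]))%:E * (g x)%:E)%E.
  apply/funext => x.
  by rewrite (integral_if_cst b)// fineK ?fin_num_measure// muleC.
by rewrite integralZl// fineK ?fin_num_measure.
Qed.

(** Exchange of the i.i.d. values: Fubini in opposite orders on the two sides yields the same
    iterated integral. *)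
Lemma integral_prod_if2 (g : R -> R) (b : R -> bool) : measurable_fun setT b ->
  P.-integrable setT (EFin \o g) ->
  (P \x P)%E.-integrable setT (fun z : R * R => (if b z.1 then g z.2 else 0)%:E) ->
  (P \x P)%E.-integrable setT (fun z : R * R => (if b z.2 then g z.1 else 0)%:E) ->
  (\int[P \x P]_z (if b z.1 then g z.2 else 0)%:E =
   \int[P \x P]_z (if b z.2 then g z.1 else 0)%:E)%E.
Proof.
by move=> mb ig i2 i1; rewrite -integral21_prod_meas1// -integral12_prod_meas1.
Qed.

End product_square.

(** * Equilibrium bids and Bob's payoff for each of his values *)

Section auction_profit.
Context {R : realType}.
Variables (P : probability R R) (L vl : R).
Hypothesis P_atomless : forall a, P [set a] = 0%E.
Hypothesis P_supp : forall a b : R, 0 <= a -> a < b -> (0 < P [set` `]a, b[])%E.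
Hypothesis P_mean : P.-integrable setT (fun x => x%:E).
Hypothesis L_gt0 : 0 < L.
Hypothesis vl_ge0 : 0 <= vl.
Hypothesis L_condmean : L = condmean P vl.
Hypothesis P_neg : P [set` `]-oo, 0[] = 0%E.

Lemma vl_gt0 : 0 < vl.
Proof.
rewrite lt_neqAle vl_ge0 andbT; apply/eqP => vl0.
(* With no mass below 0, [condmean P 0] divides by zero and is 0 by convention, contradicting
   [0 < L]. *)
by move: L_gt0; rewrite L_condmean -vl0 /condmean P_neg invr0 mulr0 ltxx.
Qed.

Lemma L_le_condmean v : vl <= v -> L <= condmean P v.
Proof. by move=> ?; rewrite L_condmean; apply: condmean_le_mono => //; exact: vl_gt0. Qed.

(** Used to get measurability of [betaL]. The branches are ordered because the truncated mean equals
    [L] at [vl] and increases from there. *)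
Lemma betaL_nondecreasing : nondecreasing_fun (betaL P L vl).
Proof.
move=> s t st; rewrite /betaL.
case: (leP vl s) => [vs|sv]; case: (leP vl t) => [vt|tv].
- by apply: condmean_le_mono => //; exact: lt_le_trans vl_gt0 _.
- by move: (lt_le_trans (le_lt_trans st tv) vs); rewrite ltxx.
- by case: ifP => _; rewrite ?L_le_condmean// (le_trans (ltW L_gt0))// L_le_condmean.
- case: (ltP L s) => Ls; first by rewrite (lt_le_trans Ls st).
  by case: ifP => // _; exact: ltW.
Qed.

Lemma betaL_below v : v < vl -> betaL P L vl v = if L < v then L else 0.
Proof. by move=> vv; rewrite /betaL leNgt vv. Qed.

Lemma betaL_above v : vl <= v -> betaL P L vl v = condmean P v.
Proof. by move=> vv; rewrite /betaL vv. Qed.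

(** Bob bids at least [L], hence beats or ties every Alice with [y < vl]; for [vl <= y] the bids
    compare as the values do. *)
Lemma bob_eq_payoff_above x y : vl <= x ->
  bob_eq_payoff P L vl (x, y) = if y <= x then x - condmean P x else 0.
Proof.
move=> vx; rewrite /bob_eq_payoff /bob_payoff /= (betaL_above _ vx) (L_le_condmean _ vx) andbT.
have x0 := lt_le_trans vl_gt0 vx.
have [vy|yv] := leP vl y.
  by rewrite betaL_above// condmean_leE//; exact: lt_le_trans vl_gt0 _.
rewrite (ltW (lt_le_trans yv vx)) betaL_below//.
by case: (L < y); rewrite ?L_le_condmean// (le_trans (ltW L_gt0))// L_le_condmean.
Qed.

(** The boundary [y = vl] is included: Alice then bids exactly [L] and the tie goes to Bob. If
    [x <= L], Bob bids 0, below the limit. *)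
Lemma bob_eq_payoff_below x y : x < vl ->
  bob_eq_payoff P L vl (x, y) = if (L < x) && (y <= vl) then x - L else 0.
Proof.
move=> xv; rewrite /bob_eq_payoff /bob_payoff /= (betaL_below _ xv).
have [Lx|xL] /= := ltP L x; last by rewrite (leNgt L) L_gt0 andbF.
rewrite lexx andbT; have [vy|yv] := leP vl y.
  rewrite betaL_above// [X in _ <= X]L_condmean condmean_leE ?vl_gt0//.
  exact: lt_le_trans vl_gt0 _.
by rewrite (ltW yv) betaL_below//; case: (L < y); rewrite ?lexx ?(ltW L_gt0).
Qed.

Lemma measurable_bob_eq_payoff : measurable_fun setT (bob_eq_payoff P L vl).
Proof.
have mb : measurable_fun setT (betaL P L vl).
  by apply: nondecreasing_measurable => //; exact: betaL_nondecreasing.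
have m1 : measurable_fun setT (fun z : R * R => betaL P L vl z.1).
  exact: measurableT_comp mb measurable_fst.
have m2 : measurable_fun setT (fun z : R * R => betaL P L vl z.2).
  exact: measurableT_comp mb measurable_snd.
apply: measurable_fun_ifT => //.
  by apply: measurable_and; apply: measurable_fun_ler.
by apply: measurable_funB => //; exact: measurable_fst.
Qed.

(** For [vl <= x] the margin lies in [[0, x]] since [L <= condmean P x <= x]; for [x < vl] the
    payoff is 0 or [x - L]. *)
Lemma integrable_bob_eq_payoff :
  (P \x P)%E.-integrable setT (EFin \o bob_eq_payoff P L vl).
Proof.
apply: (integrable_linear_growth _ P_mean _ L) => [|[x y]/=].
  exact: measurable_bob_eq_payoff.
have [vx|xv] := leP vl x.
  rewrite bob_eq_payoff_above//; case: ifP => _; last by rewrite normr0 !addr_ge0// ltW.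
  have x0 := lt_le_trans vl_gt0 vx.
  have cx : condmean P x <= x by exact: condmean_le.
  have c0 := L_le_condmean _ vx.
  rewrite (ger0_norm (ltW x0)) ger0_norm ?subr_ge0//.
  apply: (@le_trans _ _ x); first by rewrite gerBl (le_trans (ltW L_gt0)).
  by rewrite -addrA lerDl addr_ge0// ltW.
rewrite bob_eq_payoff_below//; case: ifP => _; last by rewrite normr0 !addr_ge0// ltW.
apply: (le_trans (ler_normB _ _)); rewrite (gtr0_norm L_gt0).
by rewrite lerD2r lerDl.
Qed.

(** Without atoms, weak and strict cutoffs have the same probability; this absorbs the boundary
    cases [y = x] and [y = vl]. *)
Lemma le_below_mass v : P [set` `]-oo, v]] = (mass_below P v)%:E.
Proof.
rewrite /mass_below fineK ?fin_num_measure//.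
have -> : [set` `]-oo, v]] = [set` `]-oo, v[] `|` [set v].
  by rewrite (setUitv1 true).
rewrite measureU//; first by rewrite [X in (_ + X)%E](P_atomless v) adde0.
by apply/seteqP; split => x //= [+ xv]; rewrite in_itv/= xv ltxx.
Qed.

Lemma lt_below_mass v : P [set` `]-oo, v[] = (mass_below P v)%:E.
Proof. by rewrite /mass_below fineK ?fin_num_measure. Qed.

Let t1 (z : R * R) : R :=
  Num.max ((if vl <= z.1 then z.1 else 0) - (if vl <= z.2 then z.2 else 0)) 0.
Let t2 (z : R * R) : R := if (L < z.1) && (z.1 < vl) && (z.2 < vl) then z.1 - L else 0.
(* [t3] is the last integrand of the theorem with the two coordinates swapped:
   in this form the identity already holds after integrating out Alice's value. *)
Let t3 (z : R * R) : R := if (z.2 < vl) && (vl <= z.1) then z.2 else 0.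

(** The integrands differ pointwise: Bob pays a mean of Alice's values on one side and her actual
    value on the other. They agree once [y] is averaged out. *)
Lemma inner_profit x :
  (\int[P]_y (bob_eq_payoff P L vl (x, y))%:E =
   \int[P]_y (t1 (x, y) + t2 (x, y) - t3 (x, y))%:E)%E.
Proof.
have [vx|xv] := leP vl x.
- have x0 := lt_le_trans vl_gt0 vx.
  under eq_integral do rewrite bob_eq_payoff_above//.
  have mle : measurable [set y | y <= x] by rewrite -set_itvNyc.
  rewrite integral_if_cst// -set_itvNyc le_below_mass -EFinM.
  have -> : (x - condmean P x) * mass_below P x
      = x * mass_below P x - moment_below P x.
    by rewrite condmeanE mulrBl mulfVK// gt_eqF// mass_below_gt0.
  (* Both sides are the integral of [x - y] over [y < x]. On the right, [y < vl] gives [x] from [t1]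
     minus [y] from [t3], and [vl <= y] gives the positive part of [x - y]. *)
  transitivity (\int[P]_(y in [set` `]-oo, x[]) (x - y)%:E)%E; last first.
    rewrite integral_mkcond; apply: eq_integral => y _.
    rewrite patchE mem_setE in_itv/= /t1 /t2 /t3 /= vx.
    rewrite (ltNge x) vx andbF /= addr0 andbT.
    have [vy|yv] := leP vl y.
      rewrite subr0; have [yx|xy] := ltP y x.
        by rewrite max_l// subr_ge0 ltW.
      by rewrite max_r// subr_le0.
    by rewrite (lt_le_trans yv vx) subr0 max_l// ltW.
  have -> : (\int[P]_(y in [set` `]-oo, x[]) (x - y)%:E =
     (\int[P]_(y in [set` `]-oo, x[]) (x - y))%R%:E)%E.
    rewrite fineK//; apply: integrable_fin_num => //.
    by apply: (integrableB _ (integrable_cst_on P _ x _) (integrable_id_on P P_mean _ _)).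
  by rewrite RintegralB// ?Rintegral_cst//; [exact: integrable_cst_on|exact: integrable_id_on].
- under eq_integral do rewrite bob_eq_payoff_below//.
  under [RHS]eq_integral => y _.
    rewrite /t1 /t2 /t3 /= (leNgt vl x) xv /= andbF subr0 sub0r.
    (* Here [t1] vanishes, since any subtracted [y] satisfies [0 <= vl <= y]. *)
    rewrite max_r; last by rewrite oppr_le0; case: ifP => // vy; exact: le_trans vl_ge0 _.
    rewrite add0r andbT. over.
  have mle : measurable [set y | (L < x) && (y <= vl)].
    by case: (L < x) => //=; rewrite -?set_itvNyc// set_false.
  have mlt : measurable [set y | (L < x) && (y < vl)].
    by case: (L < x) => //=; rewrite -?set_itvNyo// set_false.
  (* The two winning events differ only in the null event [y = vl]. *)
  rewrite !integral_if_cst//; congr (_ * _)%E.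
  case: (L < x) => //=.
  by rewrite -set_itvNyc -set_itvNyo le_below_mass lt_below_mass.
Qed.

(** * Integrability of the three terms and the final decomposition *)

Lemma measurable_t1 : measurable_fun setT t1.
Proof.
have m (p : R * R -> R) : measurable_fun setT p ->
    measurable_fun setT (fun z => if vl <= p z then p z else 0).
  by move=> mp; apply: measurable_fun_ifT => //; apply: measurable_fun_ler.
apply: measurable_maxr => //; apply: measurable_funB; apply: m.
  exact: measurable_fst.
exact: measurable_snd.
Qed.

Lemma integrable_t1 : (P \x P)%E.-integrable setT (EFin \o t1).
Proof.
apply: (integrable_linear_growth _ P_mean _ 0 measurable_t1) => -[x y] /=.
rewrite /t1 /= addr0 ger0_norm ?le_max ?lexx ?orbT// ge_max addr_ge0// andbT.
apply: (le_trans (ler_norm _)); apply: (le_trans (ler_normB _ _)).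
by apply: lerD; case: ifP => //; rewrite normr0.
Qed.

(** One-coordinate factors of [t2] and [t3]; what remains of each is an indicator in the other
    coordinate. *)
Let g2 (x : R) : R := if (L < x) && (x < vl) then x - L else 0.
Let g3 (x : R) : R := if x < vl then x else 0.

Lemma measurable_g2 : measurable_fun setT g2.
Proof.
apply: measurable_fun_ifT => //.
  by apply: measurable_and; apply: measurable_fun_ltr.
exact: measurable_funB.
Qed.

Lemma measurable_g3 : measurable_fun setT g3.
Proof. by apply: measurable_fun_ifT => //; apply: measurable_fun_ltr. Qed.

Lemma norm_g2 x : `|g2 x| <= `|x|.
Proof.
rewrite /g2; case: ifP => [/andP[Lx _]|_]; last by rewrite normr0.
by rewrite !ger0_norm ?subr_ge0 ?(ltW Lx)// ?(le_trans (ltW L_gt0))// ?gerBl ltW.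
Qed.

Lemma norm_g3 x : `|g3 x| <= `|x|.
Proof. by rewrite /g3; case: ifP; rewrite ?normr0. Qed.

Lemma integrable_le_id (g : R -> R) : measurable_fun setT g ->
  (forall x, `|g x| <= `|x|) -> P.-integrable setT (EFin \o g).
Proof.
move=> mg gx; apply: le_integrable P_mean => //; first exact/measurable_EFinP.
by move=> x _; rewrite /= lee_fin.
Qed.

(** [p] and [q] stand for the two projections in either order, which covers the third term both
    before and after the swap. *)
Lemma integrable_prod_if (b : R -> bool) (g : R -> R) (p q : R * R -> R) :
  measurable_fun setT b -> measurable_fun setT g -> (forall x, `|g x| <= `|x|) ->
  measurable_fun setT p -> measurable_fun setT q ->
  (forall z, `|q z| <= `|z.1| + `|z.2|) ->
  (P \x P)%E.-integrable setT (fun z : R * R => (if b (p z) then g (q z) else 0)%:E).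
Proof.
move=> mb mg gx mp mq qz.
apply: (integrable_linear_growth _ P_mean (fun z => if b (p z) then g (q z) else 0) 0).
  by apply: measurable_fun_ifT => //; exact: measurableT_comp.
move=> z; rewrite addr0; case: ifP => _; last by rewrite normr0 addr_ge0.
exact: le_trans (gx _) (qz z).
Qed.

(** Independence factors the second and third terms; the profit identity is [inner_profit]
    integrated over Bob's value. *)
Lemma profit_decomposition :
  (\int[P \x P]_z (bob_eq_payoff P L vl z)%:E =
   \int[P \x P]_z (t1 z)%:E
   + P [set` `]-oo, vl]] * \int[P]_x (g2 x)%:E
   - (1 - P [set` `]-oo, vl]]) * \int[P]_x (g3 x)%:E)%E
  /\ (\int[P \x P]_z (t2 z)%:E = P [set` `]-oo, vl]] * \int[P]_x (g2 x)%:E)%E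
  /\ (\int[P \x P]_z (if (z.1 < vl) && (vl <= z.2) then z.1 else 0)%:E
      = (1 - P [set` `]-oo, vl]]) * \int[P]_x (g3 x)%:E)%E.
Proof.
have mlt : measurable_fun setT (fun y : R => y < vl) by exact: measurable_fun_ltr.
have mge : measurable_fun setT (fun y : R => vl <= y) by exact: measurable_fun_ler.
have b1 (z : R * R) : `|z.1| <= `|z.1| + `|z.2| by rewrite lerDl.
have b2 (z : R * R) : `|z.2| <= `|z.1| + `|z.2| by rewrite lerDr.
have mf : measurable_fun setT (@fst R R) by exact: measurable_fst.
have ms : measurable_fun setT (@snd R R) by exact: measurable_snd.
have i2 := integrable_prod_if _ _ _ _ mlt measurable_g2 norm_g2 ms mf b1.
have i3 := integrable_prod_if _ _ _ _ mge measurable_g3 norm_g3 ms mf b1.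
have i3' := integrable_prod_if _ _ _ _ mge measurable_g3 norm_g3 mf ms b2.
have ig2 := integrable_le_id _ measurable_g2 norm_g2.
have ig3 := integrable_le_id _ measurable_g3 norm_g3.
have t2E : t2 = fun z => if z.2 < vl then g2 z.1 else 0.
  by apply/funext => z; rewrite /t2 /g2 andbC; case: (z.2 < vl).
have t3E : t3 = fun z => if vl <= z.1 then g3 z.2 else 0.
  by apply/funext => z; rewrite /t3 /g3 andbC; case: (vl <= z.1).
have T2 : (\int[P \x P]_z (t2 z)%:E = P [set` `]-oo, vl]] * \int[P]_x (g2 x)%:E)%E.
  by rewrite t2E (integral_prod_if1 P g2 _ mlt)// le_below_mass -lt_below_mass set_itvNyo.
have T3 : (\int[P \x P]_z (if (vl <= z.2)%R then g3 z.1 else 0)%:E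
      = (1 - P [set` `]-oo, vl]]) * \int[P]_x (g3 x)%:E)%E.
  rewrite (integral_prod_if1 P g3 _ mge)// le_below_mass -lt_below_mass.
  (* The event [vl <= y] is the complement of the open half-line, which weighs as much as the closed
     one. *)
  rewrite -probability_setC//; congr (P _ * _)%E.
  by apply/seteqP; split => y /=; rewrite in_itv/= leNgt => /negP.
split; last first.
  split=> //; rewrite -T3; apply: eq_integral => z _.
  by rewrite /g3 andbC; case: (vl <= z.2).
(* The products become double integrals again, with the third one swapped into the form of [t3] that
   [inner_profit] requires. *)
rewrite -T2 -T3 -(integral_prod_if2 P g3 _ mge)//.
rewrite -integral12_prod_meas1; last exact: integrable_bob_eq_payoff.
have it2 : (P \x P)%E.-integrable setT (EFin \o t2) by rewrite t2E.
have it3 : (P \x P)%E.-integrable setT (EFin \o t3) by rewrite t3E.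
have it12 : (P \x P)%E.-integrable setT ((EFin \o t1) \+ (EFin \o t2))%E.
  by apply: integrableD => //; exact: integrable_t1.
transitivity (\int[P \x P]_z (t1 z + t2 z - t3 z)%:E)%E.
  rewrite -integral12_prod_meas1; last exact: (integrableB _ it12 it3).
  by apply: eq_integral => x _; exact: inner_profit.
rewrite (integralB _ it12 it3)// integralD//; last exact: integrable_t1.
by rewrite t3E.
Qed.

End auction_profit.

Theorem theorem3 (R : realType) (P : probability R R) (f : R -> R) (L vl : R) :
  (* P has density f w.r.t. Lebesgue measure *)
  measurable_fun setT f -> (forall x, 0 <= f x) ->
  (forall A : set R, measurable A ->
     P A = (\int[@lebesgue_measure R]_(x in A) (f x)%:E)%E) ->
  (* support of P is R_+ *)
  P [set` `]-oo, 0[] = 0%E ->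
  (forall a b : R, 0 <= a -> a < b -> (0 < P [set` `]a, b[])%E) ->
  (* finite mean, exceeding L *)
  P.-integrable setT (fun x => x%:E) ->
  0 < L ->
  (L%:E < \int[P]_x x%:E)%E ->
  (* vl in the support, with L = E[v~ | v~ < vl] *)
  0 <= vl ->
  L = condmean P vl ->
  let PiB := (\int[P \x P]_z (bob_eq_payoff P L vl z)%:E)%E in
  let T1 := (\int[P \x P]_z
               (Num.max ((if vl <= z.1 then z.1 else 0)
                         - (if vl <= z.2 then z.2 else 0)) 0)%:E)%E in
  PiB = (T1
         + (\int[P \x P]_z
              (if (L < z.1) && (z.1 < vl) && (z.2 < vl) then z.1 - L else 0)%:E)
         - (\int[P \x P]_z
              (if (z.1 < vl) && (vl <= z.2) then z.1 else 0)%:E))%E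
  /\
  PiB = (T1
         + P [set` `]-oo, vl]] * (\int[P]_x (if (L < x) && (x < vl) then x - L else 0)%:E)
         - (1 - P [set` `]-oo, vl]]) * (\int[P]_x (if x < vl then x else 0)%:E))%E.
Proof.
move=> _ _ Pf P_neg P_supp P_mean L_gt0 _ vl_ge0 L_condmean PiB T1.
(* A density with respect to Lebesgue measure excludes atoms. *)
have P_atomless a : P [set a] = 0%E.
  by rewrite Pf// integral_set1.
have [PiBE [T2 T3]] := profit_decomposition P L vl P_atomless P_supp P_mean
  L_gt0 vl_ge0 L_condmean P_neg.
by split; rewrite /PiB PiBE// T2 T3.
Qed.
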